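(* Let $\mathcal{L}$ be downward $\preceq$-closed and ccs with $\mathrm{Fin}\subseteq\mathcal{L}\subseteq\mathrm{Scat}$. Then $E_1\le_B\underline{\bowtie}^{\mathcal{L}}_{\mathrm{LO}}$.
   Context: Linear orders are reflexive and nonempty. $L\preceq L'$ means there is an embedding $f:L\to L'$, i.e. $x\le_L y\iff f(x)\le_{L'}f(y)$. $\mathrm{LO}\subseteq 2^{\mathbb{N}\times\mathbb{N}}$ is the Polish space of codes for linear orders with domain $\mathbb{N}$; $\mathrm{Fin}$ is the set of codes for nonempty linear orders on finite subsets of $\mathbb{N}$; $\mathrm{Lin}=\mathrm{Fin}\cup\mathrm{LO}$; $\mathrm{Scat}\subseteq\mathrm{Lin}$ is the set of scattered ones (those $L$ with $\mathbb{Q}\not\preceq L$). A class $\mathcal{L}\subseteq\mathrm{Lin}$ is downward $\preceq$-closed if $K\in\mathrm{Lin}$ and $K\preceq L\in\mathcal{L}$ imply $K\in\mathcal{L}$; membership in $\mathcal{L}$ is meant up to isomorphism. A subset $I$ of a linear order $L$ is convex if $x\le_L y\le_L z$ and $x,z\in I$ imply $y\in I$. For $A,B\subseteq L$ write $A\le_L B$ (resp. $A<_L B$) if $a\le_L b$ (resp. $a<_L b$) for all $a\in A$, $b\in B$. A $K$-convex partition of $L$ is a partition $(L_k)_{k\in K}$ of $L$ (into nonempty sets) such that $k<_K k'\iff L_k<_L L_{k'}$. The relation $L\trianglelefteq^{\mathcal{L}}L'$ holds iff there are $K\in\mathcal{L}$, a $K$-convex partition $(L_k)_{k\in K}$ of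 $L$, and an embedding $f$ of $L$ into $L'$ such that $f(L_k)$ is a convex subset of $L'$ for every $k\in K$. $\trianglelefteq^{\mathcal{L}}_{\mathrm{LO}}$ is its restriction to $\mathrm{LO}$, and $L\mathrel{\underline{\bowtie}^{\mathcal{L}}_{\mathrm{LO}}}L'$ iff $L\trianglelefteq^{\mathcal{L}}_{\mathrm{LO}}L'$ and $L'\trianglelefteq^{\mathcal{L}}_{\mathrm{LO}}L$. $\mathcal{L}$ is ccs (closed under convex sums) if for all $K,K'\in\mathcal{L}$ and every family $(K'_k)_{k\in K}$ of nonempty convex subsets of $K'$ such that $k_0<_K k_1\Rightarrow K'_{k_0}\le_{K'}K'_{k_1}$, we have $\sum_{k\in K}K'_k\in\mathcal{L}$, where $\sum_{k\in K}K'_k=\{(x,k): k\in K, x\in K'_k\}$ ordered antilexicographically. When $\mathcal{L}$ is ccs, $\trianglelefteq^{\mathcal{L}}$ is a quasi-order. $E_1$ is the equivalence relation on $\mathbb{R}^{\mathbb{N}}$ given by $(x_n)\mathrel{E_1}(y_n)$ iff there is $m$ with $x_n=y_n$ for all $n\ge m$. For binary relations $E$ on $X$ and $F$ on $Y$ (standard Borel spaces), $E\le_B F$ means there is a Borel map $\varphi:X\to Y$ with $x\mathrel{E}x'\iff\varphi(x)\mathrel{F}\varphi(x')$. *)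

(* Defs.v *)
From HB Require Import structures.
From mathcomp Require Import all_boot all_order all_algebra.
From mathcomp Require Import all_classical all_reals all_analysis.

Set Implicit Arguments.
Unset Strict Implicit.
Unset Printing Implicit Defensive.

Import Order.TTheory GRing.Theory Num.Theory.
Import numFieldNormedType.Exports.

Local Open Scope classical_set_scope.

(* An order on a subset of T is represented by a reflexive relation alone:
   its domain is the set of points related to themselves. *)
Section Orders.
Context {T : Type}.
Implicit Types (r : T -> T -> Prop) (A B I : set T).

Definition dom r : set T := [set x | r x x].

Definition linear_order r : Prop :=
  [/\ dom r !=set0,
      forall x y, r x y -> dom r x /\ dom r y,
      forall x y, r x y -> r y x -> x = y,
      forall x y z, r x y -> r y z -> r x z &
      forall x y, dom r x -> dom r y -> r x y \/ r y x].

Definition strict_part r (x y : T) : Prop := r x y /\ x <> y.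

Definition set_le r A B : Prop := forall a b, A a -> B b -> r a b.

Definition set_lt r A B : Prop := forall a b, A a -> B b -> strict_part r a b.

Definition convex_subset r I : Prop :=
  I `<=` dom r /\ forall x y z, r x y -> r y z -> I x -> I z -> I y.

End Orders.

(* Maps are total for convenience; only their values on [dom r] matter. *)
Definition order_embedding {T U : Type} (r : T -> T -> Prop)
    (s : U -> U -> Prop) (f : T -> U) : Prop :=
  (forall x, dom r x -> dom s (f x)) /\
  (forall x y, dom r x -> dom r y -> (r x y <-> s (f x) (f y))).

Definition embeds {T U : Type} (r : T -> T -> Prop) (s : U -> U -> Prop) :=
  exists f : T -> U, order_embedding r s f.

Definition isomorphic {T U : Type} (r : T -> T -> Prop) (s : U -> U -> Prop) :=
  exists2 f : T -> U, order_embedding r s f & f @` dom r = dom s.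

(* The space 2^(N x N), with the product of the discrete topologies. *)
Definition lo_code := {ptws nat * nat -> bool}.

Definition le_of (c : lo_code) (m n : nat) : Prop := c (m, n).

Definition LO : set lo_code :=
  [set c | linear_order (le_of c) /\ dom (le_of c) = setT].

Definition Fin : set lo_code :=
  [set c | linear_order (le_of c) /\ finite_set (dom (le_of c))].

Definition Lin : set lo_code := Fin `|` LO.

Definition rat_order (p q : rat) : Prop := (p <= q)%R.

Definition Scat : set lo_code :=
  [set c | Lin c /\ ~ embeds rat_order (le_of c)].

Definition downward_closed (cL : set lo_code) : Prop :=
  forall K L, Lin K -> cL L -> embeds (le_of K) (le_of L) -> cL K.

Definition mem_upto_iso {T : Type} (r : T -> T -> Prop) (cL : set lo_code) : Prop :=
  exists2 M, cL M & isomorphic r (le_of M).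

(* The sum over k in K of the suborders S k of K', on the pairs (x, k). *)
Definition sum_order (K K' : lo_code) (S : nat -> set nat)
    (p q : nat * nat) : Prop :=
  [/\ dom (le_of K) p.2 /\ S p.2 p.1,
      dom (le_of K) q.2 /\ S q.2 q.1 &
      strict_part (le_of K) p.2 q.2 \/ (p.2 = q.2 /\ le_of K' p.1 q.1)].

Definition ccs (cL : set lo_code) : Prop :=
  forall (K K' : lo_code) (S : nat -> set nat), cL K -> cL K' ->
    (forall k, dom (le_of K) k ->
       S k !=set0 /\ convex_subset (le_of K') (S k)) ->
    (forall k0 k1, strict_part (le_of K) k0 k1 ->
       set_le (le_of K') (S k0) (S k1)) ->
    mem_upto_iso (sum_order K K' S) cL.

Definition convex_partition (K L : lo_code) (P : nat -> set nat) : Prop :=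
  partition (dom (le_of K)) P (dom (le_of L)) /\
  forall k k', dom (le_of K) k -> dom (le_of K) k' ->
    (strict_part (le_of K) k k' <-> set_lt (le_of L) (P k) (P k')).

Definition convex_embeds (cL : set lo_code) (L L' : lo_code) : Prop :=
  exists (K : lo_code) (P : nat -> set nat) (f : nat -> nat),
    [/\ cL K, convex_partition K L P,
        order_embedding (le_of L) (le_of L') f &
        forall k, dom (le_of K) k -> convex_subset (le_of L') (f @` P k)].

(* As a type, [LO] carries the subspace topology inherited from [lo_code]. *)
Definition convex_biembeds_LO (cL : set lo_code) (L L' : LO) : Prop :=
  convex_embeds cL (set_val L) (set_val L') /\
  convex_embeds cL (set_val L') (set_val L).

Definition borel_set {X : topologicalType} : set (set X) := <<s @open X >>.

Definition borel_map {X Y : topologicalType} (phi : X -> Y) : Prop :=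
  forall B, borel_set B -> borel_set (phi @^-1` B).

Definition borel_reducible {X Y : topologicalType}
    (E : X -> X -> Prop) (F : Y -> Y -> Prop) : Prop :=
  exists2 phi : X -> Y, borel_map phi &
    forall x x', E x x' <-> F (phi x) (phi x').

Definition E1 (R : realType) (x y : {ptws nat -> R}) : Prop :=
  exists m, forall n, (m <= n)%N -> x n = y n.

(* Main.v *)
Require Import Defs.
From mathcomp Require Import all_boot all_order all_algebra zify lra.
From mathcomp Require Import all_classical all_reals all_analysis.

Import Order.TTheory GRing.Theory Num.Theory.
Import numFieldNormedType.Exports.

Local Open Scope classical_set_scope.

(** Encode x in R^N by a linear order L_x = V + U_0^x + U_1^x + U_2^x + ... .
    Let U_n be the rationals with each q replaced by a finite chain, a block,
    whose size determines the pair (n, q).  Then U_n^x is U_n cut at x_n with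
    the two halves exchanged, that is U_n(q >= x_n) + U_n(q < x_n), and V is
    the sum, in the order type of the reversed ordinal omega, of copies of
    ... + U_2 + U_1 + U_0.

    If x and y agree from m on, L_x embeds in L_y with finitely many pieces.
    V goes onto the initial segment of V formed by all its copies except the
    last 2m; this leaves 2m copies free, and each of them receives one of the
    2m halves of U_0^x, ..., U_(m-1)^x; the tail is fixed.  Halves of U_n are
    convex in U_n, so each piece has a convex image
    ([shift_mono], [shift_convex], [tail_eq_convex_embeds]).

    Conversely, let f embed L_x in L_y with convex images of the pieces, the
    pieces being indexed by a scattered order.  Any interval of rationals on
    one side of x_n contains p < q whose blocks meet the same piece, since
    otherwise the index order would contain a copy of Q
    ([scattered_not_injective]).  As the order of blocks is dense, immediate
    successors exist only within blocks, so f maps each block strictly between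
    p and q onto a whole block of the same size, hence with the same label
    (n, q) ([block_image], [convex_embeds_matched]).  The components of V are
    well ordered by the reversed order, the types n decreasing within each
    copy, whereas the matched blocks for n = 0, 1, 2, ... form an ascending
    sequence; so for n large the matched blocks of U_n^x go to U_n^y.
    If x_n and y_n were different, choosing one matched label between them and
    one beyond y_n would give two blocks that occur in opposite orders in
    U_n^x and U_n^y.  Thus x_n = y_n for all large n
    ([convex_embeds_tail_eq]).

    Whether one point precedes another in L_x depends on at most two of the
    bits q < x_n, so x |-> L_x is Borel. *)

(** * Borel maps into spaces of codes *)

(** The codes that coincide with [c] at the places listed in [s]. *)
Definition agree_on (s : seq (nat * nat)) (c : lo_code) : set lo_code :=
  [set c' | forall p, p \in s -> c' p = c p].

Lemma nbhs_agree (c : lo_code) (A : set lo_code) :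
  nbhs c A -> exists s, agree_on s c `<=` A.
Proof.
pose F : set_system lo_code := fun B => exists s, agree_on s c `<=` B.
have FF : Filter F.
  split.
  - by exists [::].
  - move=> P Q [s sP] [t tQ]; exists (s ++ t) => c' h; split; [apply: sP|apply: tQ];
      by move=> p ps; apply: h; rewrite mem_cat ps ?orbT.
  - by move=> P Q PQ [s sP]; exists s => c' /sP /PQ.
have : F --> (c : {ptws nat * nat -> bool}).
  apply/cvg_sup => p; apply/cvg_image.
    by rewrite eqEsubset; split => // b _; exists (fun=> b).
  move=> B /= /nbhs_singleton Bc; exists ((fun c' : lo_code => c' p) @^-1` B).
    by exists [:: p] => c' /(_ p); rewrite inE eqxx /= => ->.
  rewrite image_preimage // eqEsubset; split => // b _; by exists (fun=> b).
by apply.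
Qed.

(** The basic clopen set given by finitely many prescribed bits. *)
Definition cylinder (s : seq ((nat * nat) * bool)) : set lo_code :=
  [set c | forall pb, pb \in s -> c pb.1 = pb.2].

Lemma open_bigcup_cylinders (O : set lo_code) : open O ->
  O = \bigcup_(s in [set s | cylinder s `<=` O]) cylinder s.
Proof.
move=> oO; rewrite eqEsubset; split; last by move=> c [s sO /sO].
move=> c Oc; have [s sO] : exists s, agree_on s c `<=` O.
  by apply: nbhs_agree; exact: open_nbhs_nbhs.
exists [seq (p, c p) | p <- s]; last by move=> _ /mapP[p _ ->].
move=> c' h; apply: sO => p ps.
by apply: (h (p, c p)); apply/mapP; exists p.
Qed.

Lemma borel_sigma (X : topologicalType) : sigma_algebra setT (@borel_set X).
Proof. exact: smallest_sigma_algebra. Qed.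

Lemma borel_bigcup_count (X : topologicalType) (I : countType) (D : set I)
    (F : I -> set X) :
  (forall i, D i -> borel_set (F i)) -> borel_set (\bigcup_(i in D) F i).
Proof.
move=> bF; have [b0 bC bU] := @borel_sigma X.
have -> : \bigcup_(i in D) F i = \bigcup_n
   (if unpickle n is Some i then (if i \in D then F i else set0) else set0).
  rewrite eqEsubset; split => x.
    by move=> [i Di Fix]; exists (pickle i) => //; rewrite pickleK mem_set.
  move=> [n _]; case: unpickle => // i; case: ifPn => // /set_mem Di Fix.
  by exists i.
apply: bU => n; case: unpickle => // i; case: ifPn => // /set_mem; exact: bF.
Qed.

Lemma borel_setC (X : topologicalType) (B : set X) : borel_set B -> borel_set (~` B).
Proof. by move=> bB; rewrite -setTD; have [_ bC _] := borel_sigma X; exact: bC. Qed.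

Lemma borel_setI (X : topologicalType) (B D : set X) :
  borel_set B -> borel_set D -> borel_set (B `&` D).
Proof.
move=> bB bD; rewrite -[B `&` D]setCK setCI; apply: borel_setC.
have [b0 _ bU] := borel_sigma X.
by rewrite -bigcup2E; apply: bU => -[|[|n]] //=; exact: borel_setC.
Qed.

Lemma borel_bool_fun2 (X : topologicalType) (b1 b2 : X -> bool)
    (F : bool -> bool -> bool) :
  borel_set [set x | b1 x] -> borel_set [set x | b2 x] ->
  borel_set [set x | F (b1 x) (b2 x)].
Proof.
move=> bb1 bb2.
have bit (b : X -> bool) a : borel_set [set x | b x] -> borel_set [set x | b x = a].
  case: a => // bb; rewrite (_ : [set _ | _] = ~` [set x | b x]).
    exact: borel_setC.
  by rewrite eqEsubset; split => x /=; case: (b x).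
rewrite (_ : [set _ | _] = \bigcup_(a in [set a : bool * bool | F a.1 a.2])
    ([set x | b1 x = a.1] `&` [set x | b2 x = a.2])).
  by apply: borel_bigcup_count => a _; apply: borel_setI; exact: bit.
rewrite eqEsubset; split => x /=; first by exists (b1 x, b2 x).
by move=> [[a1 a2] /= Fa [-> ->]].
Qed.

(** There are countably many cylinders, so it suffices to check the preimages
    of the subbasic sets given by one bit. *)
Lemma borel_map_codes (X : topologicalType) (A : set lo_code) (phi : X -> A) :
  (forall p, borel_set [set x | set_val (phi x) p]) -> borel_map phi.
Proof.
move=> bphi; have [b0 bC bU] := @borel_sigma X.
have bcyl s : borel_set [set x | cylinder s (set_val (phi x))].
  elim: s => [|[p b] s IH].
    rewrite (_ : [set _ | _] = setT); last by rewrite eqEsubset; split=> // x _ pb.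
    by rewrite -setC0; exact: borel_setC.
  have -> : [set x | cylinder ((p, b) :: s) (set_val (phi x))] =
    [set x | set_val (phi x) p = b] `&` [set x | cylinder s (set_val (phi x))].
    rewrite eqEsubset; split => x /=.
      move=> h; split; first by apply: (h (p, b)); rewrite inE eqxx.
      by move=> pb ps; apply: h; rewrite inE ps orbT.
    move=> [h1 h2] pb; rewrite inE => /orP[/eqP->//|]; exact: h2.
  apply: borel_setI => //; case: b; first exact: bphi.
  rewrite (_ : [set _ | _] = ~` [set x | set_val (phi x) p]).
    exact: (borel_setC _ _ (bphi p)).
  by rewrite eqEsubset; split => x /=; case: (set_val (phi x) p).
suff : @borel_set A `<=` [set B | borel_set (phi @^-1` B)] by [].
apply: smallest_sub.
  split.
  - by rewrite /= preimage_set0.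
  - by move=> B /= bB; rewrite setTD preimage_setC; exact: borel_setC.
  - by move=> F /= bF; rewrite preimage_bigcup; exact: bU.
move=> _ [ O oO <-] /=; rewrite (open_bigcup_cylinders _ oO) !preimage_bigcup.
by apply: borel_bigcup_count => s _; exact: bcyl.
Qed.

(** * Sums of finite blocks over a dense order *)

Lemma lexi_ltP d d' (A : orderType d) (B : orderType d') (x y : A *l B) :
  (x < y)%O <-> (x.1 < y.1)%O \/ x.1 = y.1 /\ (x.2 < y.2)%O.
Proof.
rewrite Order.ProdLexiOrder.ltEprodlexi.
case: (ltgtP x.1 y.1) => //= h; split=> //.
- by move=> _; left.
- by case=> // -[h']; rewrite h' ltxx in h.
- by right.
- by case=> // -[].
Qed.

(** A sum of finite chains: the points are the pairs [(c, k)] with [c : C] and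
    [k <= label c], so the block of [c] has [label c + 1] elements.  The
    bijection [e] from nat onto the set of points turns subsets and maps of
    points into subsets and maps of nat; blocks are ordered through an
    injective key [kappa] of [C] into a total order. *)
Section Blocks.
Context {C : Type} {label : C -> nat} {e : nat -> C * nat}.
Context (e_inj : injective e).
Context (e_ran : forall p : C * nat, (exists m, e m = p) <-> (p.2 <= label p.1)%N).

Section OneOrder.
Context {d : Order.disp_t} {O : orderType d}.
Context (kappa : C -> O).

Definition point_key (p : C * nat) : O *l nat := (kappa p.1, p.2).

Definition point_lt (m n : nat) := (point_key (e m) < point_key (e n))%O.

(** [n] is the immediate successor of [m]. *)
Definition covers m n := point_lt m n /\
  forall z, point_lt m z -> point_lt z n -> False.

(** Density in itself of the image of [kappa]. *)
Definition dense_range := forall c c', (kappa c < kappa c')%O ->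
  exists c'', (kappa c < kappa c'')%O /\ (kappa c'' < kappa c')%O.

Context (kappa_inj : injective kappa).

Lemma point_ltP m n : point_lt m n <->
  (kappa (e m).1 < kappa (e n).1)%O \/
  (e m).1 = (e n).1 /\ ((e m).2 < (e n).2)%N.
Proof.
rewrite /point_lt lexi_ltP /=; split=> -[|[h h']]; try by left.
- by right; split=> //; exact: kappa_inj.
- by right; rewrite h.
Qed.

(** Blocks are finite and no block is adjacent to another. *)
Lemma coversP : dense_range -> forall m n, covers m n <->
  (e m).1 = (e n).1 /\ (e n).2 = (e m).2.+1.
Proof.
move=> dk m n; split; last first.
  move=> [h1 h2]; split; first by apply/point_ltP; right; rewrite h2.
  move=> z /point_ltP + /point_ltP; rewrite h1 h2.
  move=> [hm|[hm hm2]] [hz|[hz hz2]].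
  - by move: (lt_trans hm hz); rewrite ltxx.
  - by move: hm; rewrite hz ltxx.
  - by move: hz; rewrite hm ltxx.
  - lia.
move=> [/point_ltP hlt hno].
have mn : (e m).1 = (e n).1.
  case: hlt => [hlt|[]//]; have [c [h1 h2]] := dk _ _ hlt.
  have [z zE] : exists z, e z = (c, 0%N) by apply/e_ran.
  by exfalso; apply: (hno z); apply/point_ltP; left; rewrite zE.
split=> //; case: hlt => [|[_ hlt]]; first by rewrite mn ltxx.
apply/eqP; rewrite eqn_leq hlt andbT leqNgt; apply/negP => h.
have [z zE] : exists z, e z = ((e m).1, (e m).2.+1).
  apply/e_ran => /=; rewrite mn; apply: leq_trans (ltnW h) _.
  by apply/e_ran; exists n.
by apply: (hno z); apply/point_ltP; right; rewrite zE.
Qed.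

End OneOrder.

(** Let [f] preserve the order and map the convex set [S] onto a convex set.
    If [S] meets a block before and a block after the block of [m], then [f]
    maps the block of [m] onto a whole block.  The conclusion is stated for
    the first element [m] of the block. *)
Lemma block_image d (O : orderType d) d' (O' : orderType d')
    (kappa : C -> O) (kappa' : C -> O') (f : nat -> nat) (S : set nat) :
  injective kappa -> injective kappa' ->
  dense_range kappa -> dense_range kappa' ->
  (forall m n, point_lt kappa m n = point_lt kappa' (f m) (f n)) ->
  (forall l m n, S l -> S n -> point_lt kappa l m -> point_lt kappa m n -> S m) ->
  (forall l m n, S l -> S n -> point_lt kappa' (f l) m ->
     point_lt kappa' m (f n) -> exists2 w, S w & f w = m) ->
  forall l m n, S l -> S n ->
  (kappa (e l).1 < kappa (e m).1)%O -> (kappa (e m).1 < kappa (e n).1)%O ->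
  (e m).2 = 0%N ->
  (e (f m)).2 = 0%N /\ label (e (f m)).1 = label (e m).1.
Proof.
move=> ki ki' dk dk' fmono Sconv fSconv l m n Sl Sn lm mn m0.
have inS k : (e k).1 = (e m).1 -> S k.
  by move=> h; apply: (Sconv l k n) => //; apply/point_ltP => //; left; rewrite h.
have lt_l k : (e k).1 = (e m).1 -> point_lt kappa' (f l) (f k).
  by move=> h; rewrite -fmono; apply/point_ltP => //; left; rewrite h.
have lt_n k : (e k).1 = (e m).1 -> point_lt kappa' (f k) (f n).
  by move=> h; rewrite -fmono; apply/point_ltP => //; left; rewrite h.
(* On S, the covering relation is preserved and reflected. *)
have cov u v : S u -> S v -> covers kappa u v <-> covers kappa' (f u) (f v).
  move=> Su Sv; split=> -[uv hno]; split; rewrite ?fmono // -?fmono //.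
    move=> z uz zv; have [w Sw wz] := fSconv _ _ _ Su Sv uz zv.
    by apply: (hno w); rewrite fmono wz.
  by move=> z uz zv; apply: (hno (f z)); rewrite -fmono.
have tot u v : u <> v -> point_lt kappa' u v \/ point_lt kappa' v u.
  move=> uv; rewrite /point_lt; case: ltgtP => //; try by [left|right].
  move=> [h1 h2]; case: uv; apply: e_inj.
  by rewrite [LHS]surjective_pairing [RHS]surjective_pairing h2 (ki' _ _ h1).
(* Otherwise the predecessor of f m in its block is in the image of S, and m
   would have a predecessor. *)
have f0 : (e (f m)).2 = 0%N.
  case E : (e (f m)).2 => [//|k].
  have [z zE] : exists z, e z = ((e (f m)).1, k).
    apply/e_ran => /=; have : ((e (f m)).2 <= label (e (f m)).1)%N.
      by apply/e_ran; exists (f m).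
    by lia.
  have zc : covers kappa' z (f m) by apply/coversP => //; rewrite zE E.
  have [w Sw wz] : exists2 w, S w & f w = z.
    have [->|/eqP zl] := eqVneq z (f l); first by exists l.
    apply: (fSconv l z m) => //; [exact: inS| |by case: zc].
    case: (tot z (f l) zl) => // h; exfalso.
    by case: zc => _ /(_ _ h); apply; exact: lt_l.
  move: zc; rewrite -wz -cov //; last exact: inS.
  by move=> /coversP - /(_ ki dk) [_]; rewrite m0.
split=> //.
have up k z : e z = ((e m).1, k) -> e (f z) = ((e (f m)).1, k).
  elim: k z => [|k IH] z zE.
    have -> : z = m by apply: e_inj; rewrite zE -m0 -surjective_pairing.
    by rewrite -[in RHS]f0 -surjective_pairing.
  have [z' z'E] : exists z', e z' = ((e m).1, k).
    apply/e_ran => /=; have : ((e z).2 <= label (e z).1)%N by apply/e_ran; exists z.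
    by rewrite zE /=; lia.
  have : covers kappa z' z by apply/coversP => //; rewrite zE z'E.
  rewrite cov; try by apply: inS; rewrite ?zE ?z'E.
  move=> /coversP - /(_ ki' dk') []; rewrite (IH _ z'E) /= => h1 h2.
  by rewrite [LHS]surjective_pairing h2 -h1.
have [t tE] : exists t, e t = ((e m).1, label (e m).1) by apply/e_ran.
have ftE := up _ _ tE.
have le1 : (label (e m).1 <= label (e (f m)).1)%N.
  have : ((e (f t)).2 <= label (e (f t)).1)%N by apply/e_ran; exists (f t).
  by rewrite ftE.
apply/eqP; rewrite eqn_leq le1 andbT leqNgt; apply/negP => lt1.
(* If the image block were longer, the successor z of the image of the last
   element t would be in the image of S, and t would have a successor. *)
have [z zE] : exists z, e z = ((e (f m)).1, (label (e m).1).+1) by apply/e_ran.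
have zc : covers kappa' (f t) z by apply/coversP => //; rewrite zE ftE.
have St : S t by apply: inS; rewrite tE.
have [w Sw wz] : exists2 w, S w & f w = z.
  have [->|/eqP zn] := eqVneq z (f n); first by exists n.
  apply: (fSconv t z n) => //; first by case: zc.
  case: (tot z (f n) zn) => // h; exfalso.
  case: zc => _ /(_ (f n)); apply=> //; apply: lt_n; by rewrite tE.
move: zc; rewrite -wz -cov // => /coversP - /(_ ki dk) [wE1 wE2].
have : ((e w).2 <= label (e w).1)%N by apply/e_ran; exists w.
by rewrite wE2 -wE1 tE /= ltnn.
Qed.

End Blocks.

(** * Cells and their order *)

(** A cell [(a, n, q)] is an index of a block of type [(n, q)].  It belongs to
    U_n^x if [a = 0]; if [a > 0], it belongs to the component of type [n] in
    the [a]-th copy, counted from the right, of ... + U_1 + U_0 in V. *)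
Definition cell := (nat * nat * rat)%type.

(** The size of a block, minus one; it encodes the type of the cell. *)
Definition label (c : cell) : nat := pickle (c.1.2, c.2).

Lemma label_inj c c' : label c = label c' -> c.1.2 = c'.1.2 /\ c.2 = c'.2.
Proof. by move=> /(pcan_inj pickleK) [-> ->]. Qed.

Lemma point_enumeration : exists e : nat -> cell * nat, injective e /\
  forall p, (exists m, e m = p) <-> (p.2 <= label p.1)%N.
Proof.
pose A := [set p : cell * nat | (p.2 <= label p.1)%N].
have /card_set_bijP[e [eA einj esurj]] : ([set: nat] #= A)%card.
  rewrite card_eq_le; apply/andP; split; last exact: countableP.
  apply/pcard_leP/injfunPex; exists (fun n => ((n, 0%N, 0%R : rat), 0%N)); first by [].
  by move=> i j _ _ [].
exists e; split; first by move=> i j; apply: einj; rewrite inE.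
move=> p; split; first by move=> [m <-]; exact: (eA m).
by move=> /esurj[m _ <-]; exists m.
Qed.

(** The lexicographic key of a cell, given its half [b].  Copies in V precede
    the main part and come in decreasing order of [a]; the types [n] increase
    in the main part and decrease in each copy; [b = false] is the first half. *)
Definition bit_key (b : bool) (c : cell) : int *l (int *l (nat *l rat)) :=
  (- (c.1.1%:Z)%R, (if c.1.1 == 0%N then c.1.2%:Z else - c.1.2%:Z,
    (b : nat, c.2)))%R.

Section Coding.
Context {R : realType}.
Implicit Types (x y : nat -> R) (c : cell).

(** The half of U_n^x to which a main cell belongs: [true] is the half
    [q < x_n], which is placed second.  Cells of V are not divided. *)
Definition below x c : bool := (c.1.1 == 0%N) && (ratr c.2 < x c.1.2)%R.

Definition cell_key x c := bit_key (below x c) c.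

Lemma cell_key_inj x : injective (cell_key x).
Proof.
move=> [[a n] q] [[a' n'] q'] [/= aa + _ ->].
by rewrite (_ : a = a'); [case: eqP => _ nn; congr (_, _, _); lia|lia].
Qed.

Lemma cell_ltP x c c' : (cell_key x c < cell_key x c')%O <->
  (c'.1.1 < c.1.1)%N \/ c.1.1 = c'.1.1 /\
  ((if c.1.1 == 0%N then c.1.2 < c'.1.2 else c'.1.2 < c.1.2)%N \/
  c.1.2 = c'.1.2 /\
  ((below x c < below x c')%N \/ below x c = below x c' /\ (c.2 < c'.2)%R)).
Proof.
rewrite !lexi_ltP /=.
case: c c' => [[a n] q] [[a' n'] q'] /=.
set b := below _ _; set b' := below _ _.
rewrite ltEnat -[(q < q')%O]/((q < q')%R).
case: (q < q')%R; case: b; case: b'; case: (a =P 0%N); case: (a' =P 0%N) => /=; lia.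
Qed.

Lemma below_between x a n (p q r : rat) : (p <= q)%R -> (q <= r)%R ->
  below x (a, n, p) = below x (a, n, r) -> below x (a, n, q) = below x (a, n, p).
Proof.
rewrite /below /= => pq qr; case: (a == 0%N) => //=.
have : (ratr p <= ratr q :> R)%R by rewrite ler_rat.
have : (ratr q <= ratr r :> R)%R by rewrite ler_rat.
by do 3 case: ltP => //=; lra.
Qed.

Lemma below_above x c : exists2 q, (c.2 < q)%R & below x (c.1, q) = below x c.
Proof.
case: c => [[a n] q] /=; rewrite /below /=.
case: (a == 0%N) => /=; last by exists (q + 1)%R => //; lra.
case: ltP => qx.
  have [r] := rat_in_itvoo qx; rewrite in_itv /= => /andP[qr rx].
  by exists r => //; rewrite ltr_rat in qr.
exists (q + 1)%R; first by lra.
by apply/negbTE; rewrite -leNgt rmorphD /= rmorph1; lra.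
Qed.

Lemma cell_key_dense x : dense_range (cell_key x).
Proof.
move=> [[a n] q] c' /cell_ltP /= h.
suff [r [qr rb rc']] : exists r, [/\ (q < r)%R, below x (a, n, r) = below x (a, n, q) &
    (cell_key x (a, n, r) < cell_key x c')%O].
  exists (a, n, r); split=> //; apply/cell_ltP; right=> /=.
  by split=> //; right; split=> //; right.
case: h => [h|[h1 h]].
  have [r qr rb] := below_above x (a, n, q); exists r; split=> //.
  by apply/cell_ltP; left.
case: h => [h|[h2 h]].
  have [r qr rb] := below_above x (a, n, q); exists r; split=> //; apply/cell_ltP.
  by right; split=> //; left.
case: h => [h|[h3 h4]].
  have [r qr rb] := below_above x (a, n, q); exists r; split=> //; apply/cell_ltP.
  by right; split=> //; right; split=> //; left; rewrite rb.
case: c' h1 h2 h3 h4 => [[a' n'] q'] /= <- <- h3 h4.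
have rb : below x (a, n, ((q + q') / 2)%R) = below x (a, n, q).
  by apply: below_between h3; lra.
exists ((q + q') / 2)%R; split=> //; first by lra.
apply/cell_ltP; right; split=> //; right; split=> //; right; split=> /=; last by lra.
by rewrite rb.
Qed.

(** The case where [x] and [y] agree from [m] on. *)
Section Shift.
Context (x y : nat -> R) (m : nat).
Context (xy : forall n, (m <= n)%N -> x n = y n).

(** The pieces, numbered from left to right: V, the [2 * m] halves of the first
    [m] main components, and the common tail. *)
Definition piece_index (c : cell) : nat :=
  if c.1.1 != 0%N then 0
  else if (c.1.2 < m)%N then (c.1.2.*2 + below x c).+1 else m.*2.+1.

(** V moves [2 * m] copies to the left; the piece [k] with [1 <= k <= 2 * m]
    goes to the copy [2 * m + 1 - k] of V, and the tail, whose index is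
    [2 * m + 1], goes to the main part [a = 0]. *)
Definition shift_cell (c : cell) : cell :=
  ((if c.1.1 != 0%N then c.1.1 + m.*2 else m.*2.+1 - piece_index c)%N, c.1.2, c.2).

Lemma label_shift_cell c : label (shift_cell c) = label c. Proof. by []. Qed.

Lemma piece_le c : (piece_index c <= m.*2.+1)%N.
Proof.
rewrite /piece_index; case: eqP => //= _; case: ltnP => // h.
by case: below; lia.
Qed.

Lemma piece_surj k : (k <= m.*2.+1)%N -> exists c, piece_index c = k.
Proof.
have xlt n : (x n - 1 < x n)%R by lra.
have xgt n : (x n < x n + 1)%R by lra.
case: k => [_|k]; first by exists (1, 0, 0%R)%N.
rewrite ltnS leq_eqVlt => /orP[/eqP->|km].
  by exists (0, m, 0%R)%N; rewrite /piece_index /= ltnn.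
have k2 : (k./2 < m)%N by lia.
case ko : (odd k).
  have [q] := rat_in_itvoo (xlt k./2); rewrite in_itv /= => /andP[q1 q2].
  by exists (0, k./2, q)%N; rewrite /piece_index /below /= k2 q2; lia.
have [q] := rat_in_itvoo (xgt k./2); rewrite in_itv /= => /andP[q1 q2].
by exists (0, k./2, q)%N; rewrite /piece_index /below /= k2 ltNge (ltW q1) /=; lia.
Qed.

Lemma piece_mono c c' : (cell_key x c < cell_key x c')%O ->
  (piece_index c <= piece_index c')%N.
Proof.
move=> /cell_ltP; rewrite /piece_index.
case: (below x c); case: (below x c'); case: (c.1.1 =P 0%N) => a;
  case: (c'.1.1 =P 0%N) => a' /=; case: (ltnP c.1.2 m) => n; case: (ltnP c'.1.2 m) => n'; lia.
Qed.

Lemma shift_main c : ((shift_cell c).1.1 == 0%N) = (c.1.1 == 0%N) && (m <= c.1.2)%N.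
Proof.
rewrite /shift_cell /piece_index /=; case: (c.1.1 =P 0%N) => a /=; last first.
  by rewrite addn_eq0; case: eqP.
case: ltnP => n /=; last by rewrite subnn.
by apply/negbTE/eqP; case: (below x c); lia.
Qed.

Lemma below_shift c : below y (shift_cell c) =
  ((c.1.1 == 0%N) && (m <= c.1.2)%N) && below x c.
Proof.
rewrite /below shift_main -andbA; case: (c.1.1 == 0%N) => //=.
by case: leqP => //= h; rewrite xy.
Qed.

Lemma shift_mono c c' : (cell_key x c < cell_key x c')%O ->
  (cell_key y (shift_cell c) < cell_key y (shift_cell c'))%O.
Proof.
move=> /cell_ltP h; apply/cell_ltP; rewrite !below_shift shift_main; move: h.
have bx d : below x d -> d.1.1 = 0%N by move=> /andP[/eqP].
move: (bx c) (bx c'); rewrite /shift_cell /piece_index /=.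
case: (_ < _)%R; case: (below x c); case: (below x c');
  case: (c.1.1 =P 0%N) => a; case: (c'.1.1 =P 0%N) => a' /=;
  case: (leqP m c.1.2) => n; case: (leqP m c'.1.2) => n' /=; lia.
Qed.

(** The image of each piece is convex. *)
Lemma shift_convex c c'' d : piece_index c = piece_index c'' ->
  (cell_key y (shift_cell c) <= cell_key y d)%O ->
  (cell_key y d <= cell_key y (shift_cell c''))%O ->
  exists2 c', shift_cell c' = d & piece_index c' = piece_index c.
Proof.
rewrite !leNgt => kk /negP h1 /negP h2.
move: h1; rewrite cell_ltP => h1; move: h2; rewrite cell_ltP => h2.
move: kk h1 h2; rewrite !below_shift.
case: c c'' d => [[a n] q] [[a'' n''] q''] [[A N] Q] /=.
have bs A' : A' <> 0%N -> below y (A', N, Q) = false.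
  by rewrite /below /= => /eqP/negbTE ->.
rewrite /shift_cell {-3}/piece_index /=.
case: (a =P 0%N) => [a0|a0] /=; last first.
  case: (a'' =P 0%N) => [a0''|a0''] /=; first by case: ltnP.
  move=> _ h1 h2; exists (A - m.*2, N, Q)%N => /=; last first.
    rewrite /piece_index /= (_ : (A - m.*2 == 0)%N = false) //.
    by apply/negbTE/eqP; lia.
  rewrite (_ : (A - m.*2 == 0)%N = false) /=; last by apply/negbTE/eqP; lia.
  by congr (_, _, _); lia.
case: (a'' =P 0%N) => [a0''|a0''] /=; last by case: ltnP.
rewrite /piece_index a0 a0'' /=.
case: (leqP m n) => mn; case: (leqP m n'') => mn'' kk.
- rewrite subnn /= => h1 h2; have A0 : A = 0%N by lia.
  move: h1 h2; rewrite A0 /= => h1 h2; have mN : (m <= N)%N by lia.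
  by exists (0, N, Q)%N; rewrite /= ltnNge mN //= subnn.
- by move: kk; case: (below x (0, n'', q'')%N); lia.
- by move: kk; case: (below x (0, n, q)%N); lia.
move=> h1 h2.
have [nn bb] : n = n'' /\ below x (0, n, q)%N = below x (0, n'', q'')%N.
  by move: kk; case: (below x (0, n, q)%N); case: (below x (0, n'', q'')%N); lia.
move: h1 h2; rewrite -kk -nn.
set k := (_ + _).+1%N.
have km : (k < m.*2.+1)%N by rewrite /k; case: below; lia.
rewrite (_ : (m.*2.+1 - k == 0)%N = false) /=; last by apply/negbTE/eqP; lia.
move=> h1 h2.
have Ak : A = (m.*2.+1 - k)%N by lia.
have A0 : A <> 0%N by lia.
move/eqP/negbTE: (A0) h1 h2 => -> h1 h2.
have Nn : N = n by lia.
rewrite bs // in h1 h2.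
have qQ : (q <= Q)%R.
  rewrite leNgt; apply/negP => h; apply: h1.
  by right; split=> //; right; split=> //; right.
have Qq : (Q <= q'')%R.
  rewrite leNgt; apply/negP => h; apply: h2.
  by right; split=> //; right; split=> //; right.
have bQ := below_between x 0 n q Q q'' qQ Qq.
rewrite -nn in bb; move/(_ bb): bQ => bQ.
exists (0, n, Q)%N; rewrite /= mn bQ //.
by rewrite -/k -Ak Nn.
Qed.

End Shift.
End Coding.

(** * Scattered orders and finite chains *)

(** For [a < b], an increasing map of the rationals into the interval between
    [a] and [b]. *)
Definition squeeze (a b t : rat) : rat :=
  ((a + b) / 2 + (b - a) / 2 * (t / (1 + `|t|)))%R.

Lemma squeeze_itv a b t : (a < b)%R -> (a < squeeze a b t < b)%R.
Proof.
move=> ab; rewrite /squeeze.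
have d0 : (0 < 1 + `|t|)%R by have := normr_ge0 t; lra.
have h1 : (t / (1 + `|t|) < 1)%R.
  by rewrite ltr_pdivrMr // mul1r; have := ler_norm t; lra.
have h2 : (-1 < t / (1 + `|t|))%R.
  by rewrite ltr_pdivlMr // mulN1r; have := ler_norm (- t); rewrite normrN; lra.
apply/andP; split; nra.
Qed.

Lemma squeeze_mono a b s t : (a < b)%R -> (s < t)%R ->
  (squeeze a b s < squeeze a b t)%R.
Proof.
move=> ab st; rewrite /squeeze ltrD2l ltr_pM2l; last by lra.
have ds : (0 < 1 + `|s|)%R by have := normr_ge0 s; lra.
have dt : (0 < 1 + `|t|)%R by have := normr_ge0 t; lra.
rewrite ltr_pdivrMr // mulrAC ltr_pdivlMr //.
case: (ger0P s) => s0; case: (ger0P t) => t0; nra.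
Qed.

(** A nondecreasing map from an interval of rationals to a scattered order is
    not injective. *)
Lemma scattered_not_injective (K : lo_code) (g : rat -> nat) (a b : rat) :
  linear_order (le_of K) -> ~ embeds rat_order (le_of K) -> (a < b)%R ->
  (forall p q, (a < p)%R -> (p < q)%R -> (q < b)%R -> le_of K (g p) (g q)) ->
  exists p q, [/\ (a < p)%R, (p < q)%R, (q < b)%R & g p = g q].
Proof.
move=> [_ Kdom Kanti Ktrans Ktot] nQ ab gmono; apply: contrapT => hno; apply: nQ.
pose h t := g (squeeze a b t).
have hle s t : (s < t)%R -> le_of K (h s) (h t).
  move=> st; have /andP[s1 s2] := squeeze_itv a b s ab.
  have /andP[t1 t2] := squeeze_itv a b t ab.
  by apply: gmono => //; exact: squeeze_mono.
have hdom t : dom (le_of K) (h t).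
  by have /Kdom[] : le_of K (h t) (h (t + 1)%R) by apply: hle; lra.
exists h; split=> [t _|s t _ _]; first exact: hdom.
rewrite /rat_order; split.
  by rewrite le_eqVlt => /orP[/eqP->|/hle//]; exact: hdom.
move=> hst; rewrite leNgt; apply/negP => ts; apply: hno.
have /andP[s1 s2] := squeeze_itv a b s ab.
have /andP[t1 t2] := squeeze_itv a b t ab.
exists (squeeze a b t), (squeeze a b s); split=> //; first exact: squeeze_mono.
by apply: Kanti hst; exact: hle.
Qed.

(** The finite chain 0 < 1 < ... < N. *)
Definition initial_chain (N : nat) : lo_code :=
  fun ij => (ij.1 <= ij.2)%N && (ij.2 <= N)%N.

Lemma dom_initial_chain N k : dom (le_of (initial_chain N)) k <-> (k <= N)%N.
Proof. by rewrite /dom /= /le_of /initial_chain /= leqnn. Qed.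

Lemma initial_chain_Fin N : Fin (initial_chain N).
Proof.
split.
  split; rewrite /le_of /initial_chain /=.
  - by exists 0%N.
  - by move=> x y /andP[xy yN]; split; rewrite /dom /= leqnn //= (leq_trans xy).
  - by move=> x y /andP[xy _] /andP[yx _]; apply/eqP; rewrite eqn_leq xy yx.
  - by move=> x y z /andP[xy _] /andP[yz ->]; rewrite (leq_trans xy).
  - rewrite /dom /= => x y; rewrite !leqnn /= => -> ->; rewrite !andbT.
    by apply/orP; exact: leq_total.
apply: (@sub_finite_set _ _ `I_N.+1); last exact: finite_II.
by move=> k /dom_initial_chain.
Qed.

(** * The reduction *)

Section Reduction.
Context {R : realType}.
Context (e : nat -> cell * nat) (e_inj : injective e).
Context (e_ran : forall p : cell * nat,
  (exists m, e m = p) <-> (p.2 <= label p.1)%N).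
Implicit Types (x y : nat -> R).

(** The code of L_x on the natural numbers, transported along [e].  The set of
    points does not depend on [x], so neither does [e]. *)
Definition code x : lo_code := fun ij =>
  (point_key (cell_key x) (e ij.1) <= point_key (cell_key x) (e ij.2))%O.

Local Notation lt x := (@point_lt cell e _ _ (cell_key x)).

Lemma point_key_e_inj x i j :
  point_key (cell_key x) (e i) = point_key (cell_key x) (e j) -> i = j.
Proof.
move=> [h1 h2 h3 h4 h5]; apply: e_inj.
rewrite [LHS]surjective_pairing [RHS]surjective_pairing h5; congr (_, _).
by apply: (@cell_key_inj _ x); rewrite /cell_key /bit_key h1 h2 h3 h4.
Qed.

Lemma point_lt_asym x i j : lt x i j -> ~ lt x j i.
Proof. by rewrite /point_lt => h; rewrite lt_gtF. Qed.

Lemma point_lt_total x i j : i <> j -> lt x i j \/ lt x j i.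
Proof.
rewrite /point_lt => ij; case: ltgtP => //; try by [left|right].
by move=> /(@point_key_e_inj x).
Qed.

Lemma code_le x i j : le_of (code x) i j <-> ~ lt x j i.
Proof. by rewrite /le_of /code /= leNgt; split=> /negP. Qed.

Lemma code_strict x i j : strict_part (le_of (code x)) i j <-> lt x i j.
Proof.
rewrite /strict_part /le_of /code /= /point_lt lt_neqAle; split.
  by move=> [-> ij]; rewrite andbT; apply/eqP => /point_key_e_inj.
by move=> /andP[/eqP h ->]; split=> // ij; apply: h; rewrite ij.
Qed.

Lemma dom_code x i : dom (le_of (code x)) i.
Proof. by rewrite /dom /= /le_of /code /=. Qed.

Lemma code_LO x : LO (code x).
Proof.
split; last by rewrite eqEsubset; split=> // i _; exact: dom_code.
split; rewrite /le_of /code /=.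
- by exists 0%N; exact: dom_code.
- by move=> i j _; split; exact: dom_code.
- by move=> i j ij ji; apply: (@point_key_e_inj x); apply/le_anti; rewrite ij ji.
- by move=> i j k; exact: le_trans.
- by move=> i j _ _; apply/orP; exact: le_total.
Qed.

(** Equality of tails gives an embedding with [2 * m + 2] pieces. *)
Lemma tail_eq_convex_embeds (cL : set lo_code) x y m : Fin `<=` cL ->
  (forall n, (m <= n)%N -> x n = y n) -> convex_embeds cL (code x) (code y).
Proof.
move=> FcL xy; pose g := piece_index x m; pose N := m.*2.+1.
have /choice[f fE] : forall i, exists j, e j = (shift_cell x m (e i).1, (e i).2).
  by move=> i; apply/e_ran; rewrite /= label_shift_cell; apply/e_ran; exists i.
have fmono i j : lt x i j -> lt y (f i) (f j).
  move=> /point_ltP - /(_ (@cell_key_inj _ x)) h.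
  apply/point_ltP; first exact: cell_key_inj.
  rewrite !fE /=; case: h => [h|[-> h]]; last by right.
  by left; exact: shift_mono.
have gmono i j : lt x i j -> (g (e i).1 <= g (e j).1)%N.
  move=> /point_ltP - /(_ (@cell_key_inj _ x)) [|[->//]].
  exact: piece_mono.
exists (initial_chain N), (fun k => [set i | g (e i).1 = k]), f.
split; first exact/FcL/initial_chain_Fin.
- split.
    split.
    + rewrite eqEsubset; split=> i _; first exact: dom_code.
      by exists (g (e i).1) => //; apply/dom_initial_chain; exact: piece_le.
    + by move=> k k' _ _ [i [/= <- <-]].
    + move=> k /dom_initial_chain kN; have [c cE] := piece_surj x m k kN.
      have [i iE] : exists i, e i = (c, 0%N) by apply/e_ran.
      by exists i => /=; rewrite iE.
  move=> k k' kN k'N; split.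
    move=> [/andP[/= kk' _] kk'2] i j /= ik jk'; apply/code_strict.
    have ij : i <> j by move=> ij; apply: kk'2; rewrite -ik -jk' ij.
    case: (point_lt_total x i j ij) => // /gmono; rewrite ik jk' => k'k.
    by case: kk'2; apply/eqP; rewrite eqn_leq kk' k'k.
  move=> h.
  have nonempty l : dom (le_of (initial_chain N)) l -> exists i, g (e i).1 = l.
    move=> /dom_initial_chain /(piece_surj x m) [c cE].
    have [i iE] : exists i, e i = (c, 0%N) by apply/e_ran.
    by exists i => /=; rewrite iE.
  have [i ik] := nonempty _ kN; have [j jk'] := nonempty _ k'N.
  have /code_strict ij := h _ _ ik jk'; split.
    rewrite /le_of /initial_chain /=; move/dom_initial_chain: k'N => ->.
    by rewrite andbT -ik -jk'; exact: gmono.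
  by move=> kk'; have [_] := h _ _ ik (etrans ik kk').
- split=> [i _|i j _ _]; first exact: dom_code.
  rewrite !code_le; split=> h h'; last exact/h/fmono.
  apply: h; apply: contrapT => ji.
  have [ij|ij] := eqVneq i j; first
    by apply: (point_lt_asym _ _ _ h'); rewrite ij in h' *.
  case: (point_lt_total x i j); [exact/eqP| |by []].
  by move=> /fmono; exact: point_lt_asym.
- move=> k kN; split; first by move=> i _; exact: dom_code.
  move=> i' z j' iz zj [i /= ik ii'] [j /= jk jj'].
  move: iz zj; rewrite -ii' -jj' /le_of /code /= => iz zj.
  have [c cE ck] : exists2 c, shift_cell x m c = (e z).1 & g c = g (e i).1.
    apply: (@shift_convex _ x y m xy (e i).1 (e j).1); first by rewrite [RHS]jk.
    + move: iz; rewrite Order.ProdLexiOrder.leEprodlexi /= fE => /andP[//].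
    + by move: zj; rewrite Order.ProdLexiOrder.leEprodlexi /= fE => /andP[].
  have [w wE] : exists w, e w = (c, (e z).2).
    by apply/e_ran; rewrite /= -(label_shift_cell x m) cE; apply/e_ran; exists z.
  exists w; first by rewrite /= wE /= ck.
  by apply: e_inj; rewrite fE wE /= cE -surjective_pairing.
Qed.

Lemma borel_below (c : cell) :
  borel_set ([set x | below x c] : set {ptws nat -> R}).
Proof.
apply: sub_sigma_algebra; rewrite /below.
case: eqP => _ /=; last first.
  by rewrite [X in open X](_ : _ = set0); [exact: open0|apply/seteqP; split=> z].
have pc : continuous (fun x : {ptws nat -> R} => x c.1.2).
  exact: (@proj_continuous nat (fun=> R)).
by have := (@continuousP _ _ _).1 pc _ (@open_gt R (ratr c.2)).
Qed.

Lemma borel_code i j : borel_set ([set x | code x (i, j)] : set {ptws nat -> R}).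
Proof.
pose F b b' : bool :=
  (((bit_key b (e i).1, (e i).2) : _ *l nat) <= (bit_key b' (e j).1, (e j).2))%O.
exact: (@borel_bool_fun2 _ _ _ F (borel_below (e i).1) (borel_below (e j).1)).
Qed.

(** Let [u < v] be such that no rational strictly between [u] and [v] is
    separated from another one by the cut at [x n].  Then the block of some
    such rational in U_n^x is mapped to a block of the same type. *)
Lemma convex_embeds_matched (cL : set lo_code) x y : cL `<=` Scat ->
  convex_embeds cL (code x) (code y) ->
  exists f : nat -> nat, (forall i j, lt x i j <-> lt y (f i) (f j)) /\
   forall n (u v : R), (u < v)%R ->
     (forall p q : rat, (u < ratr p < v)%R -> (u < ratr q < v)%R ->
       (ratr p < x n)%R = (ratr q < x n)%R) ->
     exists q a i, [/\ (u < ratr q < v)%R, e i = (0%N, n, q, 0%N) &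
       e (f i) = (a, n, q, 0%N)].
Proof.
move=> cLS [K [P [f [cK [[Pcov Ptriv Pne] Plt] [_ fle] fP]]]].
have [KLin Kscat] := cLS _ cK.
have Klin : linear_order (le_of K) by case: KLin => -[].
have [_ Kdom Kanti Ktrans Ktot] := Klin.
have fmono i j : lt x i j <-> lt y (f i) (f j).
  have := fle j i (dom_code _ _) (dom_code _ _); rewrite !code_le => fle'.
  by split=> h; apply: contrapT => h'; [exact: (fle'.2 h')|exact: (fle'.1 h')].
exists f; split=> // n u v uv side.
have /choice[k kP] : forall i, exists k, dom (le_of K) k /\ P k i.
  move=> i; have : dom (le_of (code x)) i by exact: dom_code.
  by rewrite -Pcov => -[k Kk Pki]; exists k.
have kE a i : dom (le_of K) a -> P a i -> k i = a.
  by move=> Ka Pai; apply: Ptriv => //; [|exists i; split=> //]; case: (kP i).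
have kmono i j : lt x i j -> le_of K (k i) (k j).
  move=> ij; case: (Ktot _ _ (kP i).1 (kP j).1) => // ji.
  have [E|/eqP ne] := eqVneq (k j) (k i); first by rewrite E; exact: (kP i).1.
  have /code_strict : strict_part (le_of (code x)) j i.
    by apply: ((Plt _ _ (kP j).1 (kP i).1).1 _ _ _ (kP j).2 (kP i).2).
  by move=> /point_lt_asym /(_ ij).
have /choice[el elE] : forall q, exists i, e i = (0%N, n, q, 0%N).
  by move=> q; apply/e_ran.
have [a] := rat_in_itvoo uv; rewrite in_itv /= => /andP[ua av].
have [b] := rat_in_itvoo av; rewrite in_itv /= => /andP[ab bv].
have inuv p : (a < p)%R -> (p < b)%R -> (u < ratr p < v)%R.
  rewrite -(ltr_rat R) -(ltr_rat R p b) => ap pb.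
  by rewrite (lt_trans ua ap) (lt_trans pb bv).
have cell_lt p q : (a < p)%R -> (p < q)%R -> (q < b)%R ->
    (cell_key x (0%N, n, p) < cell_key x (0%N, n, q))%O.
  move=> ap pq qb; apply/cell_ltP; right; split=> //; right; split=> //; right; split=> //.
  rewrite /below /=; apply: side; apply: inuv => //.
    exact: lt_trans pq qb.
  exact: lt_trans ap pq.
have el_lt p q : (a < p)%R -> (p < q)%R -> (q < b)%R -> lt x (el p) (el q).
  move=> ap pq qb; apply/point_ltP; first exact: cell_key_inj.
  by left; rewrite !elE; exact: cell_lt.
rewrite ltr_rat in ab.
have [p [q [ap pq qb kpq]]] : exists p q,
    [/\ (a < p)%R, (p < q)%R, (q < b)%R & k (el p) = k (el q)].
  apply: (@scattered_not_injective K (fun p => k (el p))) => // p q ap pq qb.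
  by apply: kmono; exact: el_lt.
(* The piece S contains the whole block of the midpoint r and meets the blocks
   of p and q on either side. *)
pose S := P (k (el p)).
have Sp : S (el p) := (kP _).2.
have Sq : S (el q) by rewrite /S kpq; exact: (kP _).2.
pose r : rat := ((p + q) / 2)%R.
have [pr rq] : (p < r)%R /\ (r < q)%R by rewrite /r; split; lra.
have [] := @block_image cell label e e_inj e_ran _ _ _ _ (cell_key x) (cell_key y) f S
    (@cell_key_inj _ x) (@cell_key_inj _ y) (@cell_key_dense _ x) (@cell_key_dense _ y) _ _ _
    (el p) (el r) (el q) Sp Sq.
- by move=> i j; apply/idP/idP => /fmono.
- move=> i j l Si Sl /kmono ij /kmono jl; rewrite /S.
  have <- : k j = k (el p); last exact: (kP j).2.
  have Kp := (kP (el p)).1.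
  by rewrite (kE _ _ Kp Si) in ij; rewrite (kE _ _ Kp Sl) in jl; exact: Kanti.
- move=> i j l Si Sl ij jl; have [_ conv] := fP _ (kP (el p)).1.
  have [w Sw wj] : (f @` P (k (el p))) j.
    apply: (conv (f i) j (f l)); [by case/code_strict: ij|by case/code_strict: jl| |].
      by exists i.
    by exists l.
  by exists w.
- by rewrite !elE; apply: cell_lt => //; lra.
- by rewrite !elE; apply: cell_lt => //; lra.
- by rewrite elE.
move=> f0; rewrite elE => /label_inj /= [fn fq].
exists r, (e (f (el r))).1.1.1, (el r); split; [|exact: elE|].
  by apply: inuv; lra.
by move: f0 fn fq; case: (e (f (el r))) => [[[? ?] ?] ?] /= -> -> ->.
Qed.

Lemma convex_embeds_tail_eq (cL : set lo_code) x y : cL `<=` Scat ->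
  convex_embeds cL (code x) (code y) -> exists m, forall n, (m <= n)%N -> x n = y n.
Proof.
move=> cLS /(@convex_embeds_matched _ _ _ cLS) [f [fmono matched]].
have lt_pointP z i j := @point_ltP _ e _ _ _ (@cell_key_inj R z) i j.
have lt_up (z : nat -> R) n n' q q' i j : (n < n')%N -> e i = (0%N, n, q, 0%N) ->
    e j = (0%N, n', q', 0%N) -> lt z i j.
  move=> nn' iE jE; apply/lt_pointP; left; rewrite iE jE; apply/cell_ltP.
  by right; split=> //; left.
(* Along ascending types, images in V move to strictly later copies. *)
have lt_down n n' q q' a a' i j : (n < n')%N -> e i = (0%N, n, q, 0%N) ->
    e j = (0%N, n', q', 0%N) -> e (f i) = (a, n, q, 0%N) ->
    e (f j) = (a', n', q', 0%N) ->
    (a' < a)%N \/ a = 0%N /\ a' = 0%N.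
  move=> nn' iE jE fiE fjE; have /fmono/lt_pointP := lt_up x _ _ _ _ _ _ nn' iE jE.
  rewrite fiE fjE => -[/cell_ltP|[[]]] /=; last by lia.
  by case: (a =P 0%N) => a0; lia.
(* All rationals in the interval from x n to x n + 1 are in the first half. *)
have ex n : exists a i, exists2 q, e i = (0%N, n, q, 0%N) & e (f i) = (a, n, q, 0%N).
  have [|p q /andP[p1 _] /andP[q1 _]|q [a [i [_ iE fiE]]]] :=
    matched n (x n) (x n + 1)%R.
  - by lra.
  - by rewrite (lt_gtF p1) (lt_gtF q1).
  - by exists a, i, q.
have /choice[a /choice[i aiE]] := ex.
(* Starting in copy a 0 of V, the images move at each step to a copy with a
   smaller index, until they reach the main part. *)
have a_bound n : a n = 0%N \/ (a n + n <= a 0)%N.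
  elim: n => [|n IH]; first by right; rewrite addn0.
  have [q iE fiE] := aiE n; have [q' iE' fiE'] := aiE n.+1.
  by case: (lt_down _ _ _ _ _ _ _ _ (ltnSn n) iE iE' fiE fiE'); lia.
exists (a 0).+2 => n mn.
(* The block chosen for n - 1 already goes to the main part, and the blocks of
   type n come later. *)
have main a' j q : e j = (0%N, n, q, 0%N) -> e (f j) = (a', n, q, 0%N) ->
    e (f j) = (0%N, n, q, 0%N).
  move=> jE fjE; have [q' iE fiE] := aiE n.-1.
  have nn : (n.-1 < n)%N by lia.
  have a'0 : a' = 0%N.
    have b := a_bound n.-1; have := lt_down _ _ _ _ _ _ _ _ nn iE jE fiE fjE; lia.
  by rewrite fjE a'0.
have below0 (z : nat -> R) q : below z (0%N, n, q) = (ratr q < z n)%R by [].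
have mono q q' j j' : below x (0%N, n, q) = below x (0%N, n, q') -> (q < q')%R ->
    e j = (0%N, n, q, 0%N) -> e j' = (0%N, n, q', 0%N) ->
    e (f j) = (0%N, n, q, 0%N) -> e (f j') = (0%N, n, q', 0%N) ->
    (below y (0%N, n, q) <= below y (0%N, n, q'))%N.
  move=> bq qq' jE jE' fjE fjE'.
  have /fmono/lt_pointP : lt x j j'.
    apply/lt_pointP; left; rewrite jE jE'; apply/cell_ltP.
    by right; split=> //; right; split=> //; right.
  rewrite fjE fjE' => -[/cell_ltP/=|[[]]]; last by move=> _; rewrite ltnn.
  by move=> [//|[_ [|[_ [/ltnW//|[->]]]]]]; rewrite ?ltnn ?leqnn.
have [xy|yx|//] := ltgtP (x n) (y n).
(* A label q between x n and y n, and a label q' > y n: in L_x both are in the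
   first half, in L_y the second half contains q only. *)
- have [p q /andP[p1 _] /andP[q1 _]|q [? [j [/andP[xq qy] jE /(main _ _ _ jE) fjE]]]] :=
    matched n (x n) (y n) xy.
  + by rewrite (lt_gtF p1) (lt_gtF q1).
  have [||q' [? [j' [/andP[yq' _] jE' /(main _ _ _ jE') fjE']]]] :=
    matched n (y n) (y n + 1)%R.
  + by lra.
  + move=> p r /andP[p1 _] /andP[r1 _].
    by rewrite (lt_gtF (lt_trans xy p1)) (lt_gtF (lt_trans xy r1)).
  have qq' : (q < q')%R by rewrite -(ltr_rat R) (lt_trans qy).
  have := mono _ _ _ _ _ qq' jE jE' fjE fjE'.
  rewrite !below0 (lt_gtF xq) (lt_gtF (lt_trans xy yq')) qy (lt_gtF yq').
  by move=> /(_ erefl).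
(* A label q between y n and x n, and a label q' < y n: in L_x both are in the
   second half, in L_y the second half contains q' only. *)
- have [p q /andP[_ p1] /andP[_ q1]|q [? [j [/andP[yq qx] jE /(main _ _ _ jE) fjE]]]] :=
    matched n (y n) (x n) yx.
  + by rewrite p1 q1.
  have [||q' [? [j' [/andP[_ yq'] jE' /(main _ _ _ jE') fjE']]]] :=
    matched n (y n - 1)%R (y n).
  + by lra.
  + by move=> p r /andP[_ p1] /andP[_ r1]; rewrite (lt_trans p1 yx) (lt_trans r1 yx).
  have qq' : (q' < q)%R by rewrite -(ltr_rat R) (lt_trans yq').
  have := mono _ _ _ _ _ qq' jE' jE fjE' fjE.
  rewrite !below0 qx (lt_trans yq' yx) yq' (lt_gtF yq).
  by move=> /(_ erefl).
Qed.

End Reduction.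

Theorem theorem6p4 (R : realType) (cL : set lo_code) :
  downward_closed cL -> ccs cL -> Fin `<=` cL -> cL `<=` Scat ->
  borel_reducible (@E1 R) (@convex_biembeds_LO cL).
Proof.
move=> _ _ FcL cLS; have [e [e_inj e_ran]] := point_enumeration.
have phiP (x : {ptws nat -> R}) : code e x \in LO by rewrite inE; exact: code_LO.
exists (fun x => exist _ (code e x) (phiP x)).
  by apply: borel_map_codes => -[i j] /=; exact: borel_code.
move=> x x'; split.
  move=> [m xx']; split; apply: (@tail_eq_convex_embeds _ e e_inj e_ran _ _ _ m) => //.
  by move=> n mn; rewrite xx'.
by move=> [h _]; exact: (@convex_embeds_tail_eq _ e e_inj e_ran _ _ _ cLS h).
Qed.
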